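(* Let $p$ be a prime and let $J_p$ be the ring of $p$-adic integers. For every finite $0$-$1$ sequence $s$, writing $n=\operatorname{length}(s)$, choose a random integer $a_s$ uniformly distributed on $\{0,1,\dots,p^{2^{n+1}-2^n}-1\}$, all the $a_s$ being independent (in particular $a_{\langle\rangle}\in\{0,1,\dots,p-1\}$ for the empty sequence $\langle\rangle$). For every infinite $0$-$1$ sequence $f\in\{0,1\}^{\omega}$ define the $p$-adic integer $$\xi_f := \sum_{n=0}^{\infty} p^{2^n-1}\, a_{f\restriction n}\in J_p,$$ where $f\restriction n$ is the initial segment of $f$ consisting of $n$ elements. Then almost surely the $2^{\aleph_0}$ elements $\xi_f$, $f\in\{0,1\}^\omega$, are algebraically independent; that is, with probability $1$, for every $k\ge1$, all pairwise distinct $f_1,\dots,f_k\in\{0,1\}^\omega$ and every non-zero polynomial $g\in\mathbb{Z}[x_1,\dots,x_k]$, one has $g(\xi_{f_1},\dots,\xi_{f_k})\ne 0$.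
   Context: Algebraic independence is over $\mathbb{Z}$ (equivalently over $\mathbb{Q}$). ''Almost surely'' means with probability $1$; the assertion is that the single event ''the whole uncountable family $(\xi_f)_f$ is algebraically independent'' has probability $1$. *)

(* Defs.v *)
From HB Require Import structures.
From mathcomp Require Import all_boot all_order all_algebra.
From mathcomp Require Import finmap.
From mathcomp Require mpoly.
From mathcomp Require Import all_classical all_reals all_analysis.
(* The notations of mpoly clash with those of mathcomp-analysis. *)
Import (canonicals) mpoly.

Set Implicit Arguments.
Unset Strict Implicit.
Unset Printing Implicit Defensive.

Import Order.TTheory GRing.Theory Num.Theory.

Local Open Scope classical_set_scope.
Local Open Scope ring_scope.

(* The ring J_p is the inverse limit of the rings Z/p^(n+1)Z, with the p-adic
   (inverse limit of discrete) topology. Exponents start at 1 because 'Z_1 is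
   Z/2Z in MathComp; the definition is meaningful only for p > 1. *)
Record padic (p : nat) := Padic {
  res : forall n : nat, 'Z_(p ^ n.+1);
  res_coherent : forall n, inZp (res n.+1) = res n }.

Arguments Padic {p}.
Arguments res {p}.

HB.instance Definition _ p := gen_eqMixin (padic p).
HB.instance Definition _ p := gen_choiceMixin (padic p).

Lemma padicP p (x y : padic p) : (forall n, res x n = res y n) -> x = y.
Proof.
case: x y => [x cx] [y cy] /= xy.
have {}xy : x = y by apply: functional_extensionality_dep.
by rewrite {}xy in cx *; congr Padic; exact: Prop_irrelevance.
Qed.

Section Ring.
Variable p : nat.

Lemma Zp_trunc_dvd n :
  ((Zp_trunc (p ^ n.+1)).+2 %| (Zp_trunc (p ^ n.+2)).+2)%N.
Proof.
case: p => [|[|q]]; rewrite ?exp0n ?exp1n //.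
have gt1 m : (1 < q.+2 ^ m.+1)%N by rewrite -{1}(expn0 q.+2) ltn_exp2l.
by rewrite !Zp_cast ?dvdn_exp2l.
Qed.

Let pi n (x : 'Z_(p ^ n.+2)) : 'Z_(p ^ n.+1) := inZp x.

Let piD n : {morph @pi n : x y / x + y}.
Proof.
by move=> x y; apply: val_inj; rewrite /= modn_dvdm ?Zp_trunc_dvd // modnDm.
Qed.

Let piM n : {morph @pi n : x y / x * y}.
Proof.
by move=> x y; apply: val_inj; rewrite /= modn_dvdm ?Zp_trunc_dvd // modnMm.
Qed.

Let pi0 n : @pi n 0 = 0. Proof. by apply: val_inj; rewrite /= mod0n. Qed.

Let pi1 n : @pi n 1 = 1. Proof. by apply: val_inj. Qed.

Let piN n : {morph @pi n : x / - x}.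
Proof. by move=> x; apply/eqP; rewrite -addr_eq0 -piD addNr pi0. Qed.

Implicit Types x y z : padic p.

Definition padic_zero : padic p := Padic (fun n => 0) (@pi0).
Definition padic_one : padic p := Padic (fun n => 1) (@pi1).

Definition padic_opp x : padic p.
Proof.
exists (fun n => - res x n) => n.
by rewrite -/(pi _) piN /pi res_coherent.
Defined.

Definition padic_add x y : padic p.
Proof.
exists (fun n => res x n + res y n) => n.
by rewrite -/(pi _) piD /pi !res_coherent.
Defined.

Definition padic_mul x y : padic p.
Proof.
exists (fun n => res x n * res y n) => n.
by rewrite -/(pi _) piM /pi !res_coherent.
Defined.

Fact padic_addA : associative padic_add.
Proof. by move=> x y z; apply: padicP => n /=; rewrite addrA. Qed.
Fact padic_addC : commutative padic_add.
Proof. by move=> x y; apply: padicP => n /=; rewrite addrC. Qed.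
Fact padic_add0 : left_id padic_zero padic_add.
Proof. by move=> x; apply: padicP => n /=; rewrite add0r. Qed.
Fact padic_addN : left_inverse padic_zero padic_opp padic_add.
Proof. by move=> x; apply: padicP => n /=; rewrite addNr. Qed.

HB.instance Definition _ := GRing.isZmodule.Build (padic p)
  padic_addA padic_addC padic_add0 padic_addN.

Fact padic_mulA : associative padic_mul.
Proof. by move=> x y z; apply: padicP => n /=; rewrite mulrA. Qed.
Fact padic_mulC : commutative padic_mul.
Proof. by move=> x y; apply: padicP => n /=; rewrite mulrC. Qed.
Fact padic_mul1 : left_id padic_one padic_mul.
Proof. by move=> x; apply: padicP => n /=; rewrite mul1r. Qed.
Fact padic_mulD : left_distributive padic_mul padic_add.
Proof. by move=> x y z; apply: padicP => n /=; rewrite mulrDl. Qed.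
Fact padic_1neq0 : padic_one != 0.
Proof.
apply/eqP => /(congr1 (fun x => res x 0%N)) /= /eqP.
by rewrite oner_eq0.
Qed.

HB.instance Definition _ := GRing.Zmodule_isComNzRing.Build (padic p)
  padic_mulA padic_mulC padic_mul1 padic_mulD padic_1neq0.

Lemma res0 n : res (0 : padic p) n = 0. Proof. by []. Qed.
Lemma res1 n : res (1 : padic p) n = 1. Proof. by []. Qed.
Lemma resD x y n : res (x + y) n = res x n + res y n. Proof. by []. Qed.
Lemma resN x n : res (- x) n = - res x n. Proof. by []. Qed.
Lemma resM x y n : res (x * y) n = res x n * res y n. Proof. by []. Qed.

Lemma res_nat k n : res (k%:R : padic p) n = k%:R.
Proof. by elim: k => [|k IHk] //; rewrite !mulrS resD IHk. Qed.

Lemma res_sum I (r : seq I) (F : I -> padic p) n :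
  res (\sum_(i <- r) F i) n = \sum_(i <- r) res (F i) n.
Proof.
exact: (big_morph (fun x : padic p => res x n) (fun x y => resD x y n)).
Qed.

Lemma res_le x y m n : (m <= n)%N -> res x n = res y n -> res x m = res y m.
Proof.
elim: n => [|n IHn]; first by rewrite leqn0 => /eqP ->.
rewrite leq_eqVlt => /orP[/eqP -> //|/IHn {}IHn xy]; apply: IHn.
by rewrite -[LHS]res_coherent -[RHS]res_coherent xy.
Qed.

End Ring.

Section Topology.
Variable p : nat.
Implicit Types x y l : padic p.

HB.instance Definition _ := isPointed.Build (padic p) 0.

Definition padic_nbhs x : set_system (padic p) :=
  [set A | exists n, [set y | res y n = res x n] `<=` A].

HB.instance Definition _ := hasNbhs.Build (padic p) padic_nbhs.

Fact padic_nbhs_filter x : ProperFilter (nbhs x).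
Proof.
split; first by case=> n /(_ x); exact.
split=> [|A B [m mA] [n nB]|A B AB [n nA]]; first by exists 0%N.
  exists (maxn m n) => y /= yx.
  by split; [apply: mA|apply: nB]; apply: res_le yx;
    rewrite ?leq_maxl ?leq_maxr.
by exists n => y /nA /AB.
Qed.

Fact padic_nbhs_singleton x (A : set (padic p)) : nbhs x A -> A x.
Proof. by case=> n; exact. Qed.

Fact padic_nbhs_nbhs x (A : set (padic p)) : nbhs x A -> nbhs x (nbhs^~ A).
Proof.
by case=> n nA; exists n => y /= yx; exists n => z /= zy; apply: nA => /=; rewrite zy.
Qed.

HB.instance Definition _ := Nbhs_isNbhsTopological.Build (padic p)
  padic_nbhs_filter padic_nbhs_singleton padic_nbhs_nbhs.

Lemma padic_hausdorff : hausdorff_space (padic p).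
Proof.
move=> x y xy; apply: padicP => n.
have [] := xy [set z | res z n = res x n] [set z | res z n = res y n].
- by exists n.
- by exists n.
by move=> z [<- <-].
Qed.

Lemma padic_cvgP (u : nat -> padic p) l :
  u @ \oo --> l <-> forall n, \forall m \near \oo, res (u m) n = res l n.
Proof.
split=> [ul n|ul A [n nA]]; first by apply: (ul [set y | res y n = res l n]); exists n.
apply: filterS (ul n) => m /=; exact: nA.
Qed.

End Topology.

Section Xi.
Variables (p : nat) (a : seq bool -> nat).

(* mkseq f n is the initial segment [:: f 0; ...; f n.-1] *)
Definition xi (f : nat -> bool) : padic p :=
  limn (fun N =>
    \sum_(0 <= n < N) p%:R ^+ (2 ^ n - 1) * (a (mkseq f n))%:R : padic p).

Lemma xi_cvg (f : nat -> bool) : prime p ->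
  (fun N =>
    \sum_(0 <= n < N) p%:R ^+ (2 ^ n - 1) * (a (mkseq f n))%:R : padic p)
    @ \oo --> xi f.
Proof.
move=> pr_p.
set u := fun n => p%:R ^+ (2 ^ n - 1) * (a (mkseq f n))%:R : padic p.
have u0 k n : (k < n)%N -> res (u n) k = 0.
  move=> kn; rewrite /u -natrX -natrM res_nat; apply: val_inj.
  rewrite /= val_Zp_nat.
    apply/eqP; rewrite -/(dvdn _ _) dvdn_mulr // dvdn_exp2l //.
    by apply: (leq_trans kn); rewrite subn1 -ltnS prednK ?expn_gt0 // ltn_expl.
  by rewrite -{1}(expn0 p) ltn_exp2l ?prime_gt1.
pose s N := \sum_(0 <= n < N) u n.
have sE k N : (k < N)%N -> res (s N) k = res (s k.+1) k.
  move=> kN; rewrite /s (big_cat_nat (n := k.+1)) // resD.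
  rewrite [X in _ + X]res_sum [X in _ + X]big_nat [X in _ + X]big1 ?addr0 //.
  by move=> n /andP[kn _]; exact: u0.
have l_coherent k : inZp (res (s k.+2) k.+1) = res (s k.+1) k.
  by rewrite res_coherent sE.
pose l := Padic (fun k => res (s k.+1) k) l_coherent.
suff sl : s @ \oo --> (l : padic p).
  by rewrite /xi (cvg_lim (@padic_hausdorff p) sl).
apply/padic_cvgP => k; exists k.+1 => // N /= kN; exact: sE.
Qed.

End Xi.

(* Algebraic independence over Z of the family x. *)
Definition algebraically_independent (A : comNzRingType) (I : Type)
    (x : I -> A) : Prop :=
  forall (k : nat) (i : 'I_k -> I), (0 < k)%N -> injective i ->
  forall g : mpoly.mpoly k int, g != 0 -> mpoly.mmap intr (x \o i) g != 0.

Section Probability.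
Context d (T : measurableType d) (R : realType) (P : probability T R).

Definition mutually_independent d' (T' : measurableType d') (I : choiceType)
    (X : I -> {RV P >-> T'}) : Prop :=
  forall (J : {fset I}) (B : I -> set T'),
  (forall i, i \in J -> measurable (B i)) ->
  P (\bigcap_(i in [set` J]) (X i @^-1` B i)) =
  (\prod_(i <- J) P (X i @^-1` B i))%E.

(* These N equal masses add up to 1, so X has no mass outside {0, .., N - 1}. *)
Definition uniform_below (N : nat) (X : {RV P >-> nat}) : Prop :=
  forall k, (k < N)%N -> P (X @^-1` [set k]) = (N%:R^-1)%:E.

End Probability.

(* Main.v *)
(* Fix a non-zero g in k variables and a length M at which the prefixes of
   f_1, .., f_k already differ. If g(xi_{f_1}, .., xi_{f_k}) = 0, then for every
   N > M the residues of the xi_{f_i} modulo p^m, m = 2^N - 1, form a zero of g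
   modulo p^m. These residues depend only on the prefixes of length N, of which
   there are 2^(Nk) systems, and the digits a_s with M <= size s < N in them are
   independent, so each residue vector has probability at most
   p^(k 2^M) p^(- m k). On the other hand g has at most C p^(m k - m / B) zeros
   modulo p^m, with B and C depending only on g. Hence the exceptional event has
   outer probability at most 2^(Nk) C p^(k 2^M) p^(- (2^N - 1) / B), which tends
   to 0 because the last exponent is exponential in N. There are only countably
   many triples (k, g, M). *)
Require Import Defs.
From mathcomp Require Import all_boot all_order all_algebra.
From mathcomp Require Import finmap.
From mathcomp Require mpoly.
From mathcomp Require Import all_classical all_reals all_analysis.
From mathcomp Require Import zify ring.
Import -(notations) mpoly.

Set Implicit Arguments.
Unset Strict Implicit.
Unset Printing Implicit Defensive.

Import Order.TTheory GRing.Theory Num.Theory.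
Local Open Scope ring_scope.

(** * Polynomials in [k.+1] variables as polynomials in the last one *)

Lemma mnm_eq_widen_max k (m m' : multinom k.+1) :
  (forall i : 'I_k, m (widen_ord (leqnSn k) i) = m' (widen_ord (leqnSn k) i)) ->
  m ord_max = m' ord_max -> m = m'.
Proof.
move=> mm' mx; apply/mnmP => i.
have [->//|i0] := eqVneq i ord_max.
have ik : (i < k)%N by rewrite ltn_neqAle -ltnS ltn_ord andbT -val_eqE in i0 *.
by have := mm' (Ordinal ik); rewrite (_ : widen_ord _ _ = i) //; apply: val_inj.
Qed.

(** A monomial is determined by its last exponent and its truncation to the first [k] variables, so
    distinct monomials of [g] cannot cancel inside [muni g]. *)
Lemma muni_neq0 k (R : nzRingType) (g : mpoly k.+1 R) :
  g != 0 -> exists j, (muni g)`_j != 0.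
Proof.
move=> g0.
have [m mg] : exists m, m \in msupp g.
  case E : (msupp g) => [|m s]; last by exists m; rewrite inE eqxx.
  by move: E g0 => /eqP; rewrite msupp_eq0 => ->.
exists (m ord_max).
pose r (m : multinom k.+1) := Multinom [tuple m (widen_ord (leqnSn k) i) | i < k].
apply: contraTneq mg => /(congr1 (mcoeff (r m))).
rewrite muniE coef_sum mcoeff0 raddf_sum /=.
rewrite (eq_bigr (fun m' => if m' == m then mcoeff m g else 0)); last first.
  move=> m' _; rewrite coefZ coefXn mulr_natr raddfMn /= mcoeffZ mcoeffX.
  have [->|m'm] := eqVneq m' m; first by rewrite !eqxx /= mulr1 mulr1n.
  have [mE|] := eqVneq (m ord_max) (m' ord_max); last by rewrite mulr0n.
  have [rE|] := eqVneq (Multinom _) (r m); last by rewrite mulr0 mul0rn.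
  case/eqP: m'm; apply: mnm_eq_widen_max => // i.
  by move/mnmP/(_ i): rE; rewrite !mnmE.
rewrite -big_mkcond /= => E; apply/negP => mg.
move: E; rewrite -big_filter filter_pred1_uniq ?msupp_uniq // big_seq1.
by apply/eqP; rewrite -mcoeff_msupp.
Qed.

Lemma meval_muni k (R : comNzRingType) (g : mpoly k.+1 R) v :
  meval v g =
  (map_poly (meval (fun i => v (widen_ord (leqnSn k) i))) (muni g)).[v ord_max].
Proof.
rewrite muniE mevalE !rmorph_sum /= horner_sum.
apply: eq_bigr => m _.
rewrite map_polyZ map_polyXn !hornerE /= mevalZ mevalX -mulrA; congr (_ * _).
rewrite big_ord_recr /=; congr (_ * _).
by apply: eq_bigr => i _; rewrite mnmE.
Qed.

(** * Counting zeros modulo powers of [p] *)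

Section Counting.
Variable p : nat.
Hypothesis pr_p : prime p.

Lemma dvdz_pfactor_cancel q m (a b : int) : ~~ ((p ^ q)%:Z %| a)%Z ->
  ((p ^ (m + q))%:Z %| a * b)%Z -> ((p ^ m)%:Z %| b)%Z.
Proof.
rewrite !dvdzE !absz_nat abszM.
have [->|b0] := posnP `|b|%N; first by rewrite dvdn0.
have [->|a0] := posnP `|a|%N; first by rewrite dvdn0.
rewrite !pfactor_dvdn ?muln_gt0 ?a0 // lognM // -ltnNge; lia.
Qed.

(* Dividing h - h(x) by X - x lowers the degree and costs a factor p^q at each
   of the other zeros. *)
Lemma dvdz_coef_of_zeros q e n (h : {poly int}) (s : seq int) :
  (size h <= n)%N -> size s = n ->
  pairwise (fun x y => ~~ ((p ^ q)%:Z %| y - x)%Z) s ->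
  all (fun x => (p ^ (e + q * n))%:Z %| h.[x])%Z s ->
  forall j, ((p ^ e)%:Z %| h`_j)%Z.
Proof.
elim: n => [|n IHn] in h s *.
  by rewrite leqn0 size_poly_eq0 => /eqP -> _ _ _ j; rewrite coef0 dvdz0.
case: s => // x s hn [sn] /= /andP[xs spw] /andP[hx hs].
have /factor_theorem[h' h'E] : root (h - h.[x]%:P) x.
  by rewrite /root !hornerE subrr.
have hE : h = h' * ('X - x%:P) + h.[x]%:P by rewrite -h'E subrK.
have h'n : (size h' <= n)%N.
  have [->|h'0] := eqVneq h' 0; first by rewrite size_poly0.
  have := size_Mmonic h'0 (monicXsubC x); rewrite -h'E size_XsubC addn2 /= => E.
  rewrite -ltnS -E (leq_trans (size_polyD _ _)) // size_polyN geq_max hn.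
  exact: leq_trans (size_polyC_leq1 _) _.
have dx : ((p ^ e)%:Z %| h.[x])%Z.
  by apply: dvdz_trans hx; rewrite dvdzE !absz_nat dvdn_exp2l ?leq_addr.
have {}IHn := IHn h' s h'n sn spw.
have {}IHn j : ((p ^ e)%:Z %| h'`_j)%Z.
  apply: IHn; apply/allP => y ys; have := allP hs _ ys => hy.
  have := allP xs _ ys => /dvdz_pfactor_cancel; apply.
  rewrite mulrC.
  have -> : h'.[y] * (y - x) = h.[y] - h.[x].
    by rewrite {1}hE !hornerE addrK.
  by rewrite -addnA -mulnSr rpredB.
move=> j; rewrite hE coefD coefC mulrBr coefB coefMX coefMC.
by rewrite rpredD ?rpredB ?dvdz_mulr //; case: ifP => // _; rewrite dvdz0.
Qed.

(** By [dvdz_coef_of_zeros], [n] zeros in distinct classes modulo [p ^ q] would make [p ^ e] divide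
    every coefficient. So the zeros meet at most [n] classes, each of size [p ^ (m - q)]. *)
Lemma card_poly_zeros_mod q e m n (h : {poly int}) j :
  (size h <= n)%N -> (q <= m)%N -> ~~ ((p ^ e)%:Z %| h`_j)%Z ->
  (#|[set y : 'I_(p ^ m) | ((p ^ (e + q * n))%:Z %| h.[(y : nat)%:Z])%Z]|
     <= n * p ^ (m - q))%N.
Proof.
move=> hn qm hj; set Y := [set y | _].
have pq : (0 < p ^ q)%N by rewrite expn_gt0 prime_gt0.
have pmq : (p ^ (m - q) * p ^ q = p ^ m)%N by rewrite -expnD subnK.
pose r (y : 'I_(p ^ m)) : 'I_(p ^ q) := Ordinal (ltn_pmod y pq).
have dlt (y : 'I_(p ^ m)) : (y %/ p ^ q < p ^ (m - q))%N.
  by rewrite ltn_divLR // pmq.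
pose f y := (r y, Ordinal (dlt y)).
have f_inj : injective f.
  move=> y z [/= rE dE]; apply: val_inj.
  by rewrite /= (divn_eq y (p ^ q)) rE dE -divn_eq.
have /leq_trans -> // :
  (#|Y| <= #|finset.setX (r @: Y)%SET [set: 'I_(p ^ (m - q))]%SET|)%N.
  rewrite -(card_imset _ f_inj); apply/subset_leq_card/fintype.subsetP
    => _ /imsetP[y yY ->].
  by rewrite !inE /= imset_f.
rewrite cardsX cardsT card_ord leq_mul2r; apply/orP; right.
rewrite leqNgt; apply/negP => nY.
have [g gY gr] : exists2 g : 'I_(p ^ q) -> 'I_(p ^ m),
    {in (r @: Y)%SET, forall z, g z \in Y} & {in (r @: Y)%SET, cancel g r}.
  have [y0 _] : exists y0, y0 \in Y.
    apply/finset.set0Pn; apply: contraTneq nY => ->.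
    by rewrite imset0 cards0.
  (* [y0] is only a default: on the image of [r] the [pick] succeeds. *)
  exists (fun z => odflt y0 [pick y in Y | r y == z]) => z /imsetP[y yY ->];
    by case: pickP => [w /andP[wY /eqP]|/(_ y)]; rewrite ?yY ?eqxx.
move/negP: hj; apply.
pose s := [seq (g z : nat)%:Z | z <- take n (enum (r @: Y)%SET)].
have sub z : z \in take n (enum (r @: Y)%SET) -> z \in (r @: Y)%SET.
  by move=> /mem_take; rewrite mem_enum.
apply: (@dvdz_coef_of_zeros q e n h s hn).
- by rewrite size_map size_takel // -cardE ltnW.
- rewrite pairwise_map.
  have : uniq (take n (enum (r @: Y)%SET)) by rewrite take_uniq ?enum_uniq.
  rewrite uniq_pairwise; apply: (@sub_in_pairwise _ [in (r @: Y)%SET]);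
    last exact/allP.
  move=> x y xY yY xy.
  apply: contra xy => xy; apply/eqP; rewrite -(gr x xY) -(gr y yY).
  apply: val_inj => /=; apply/eqP.
  by move: xy; rewrite -eqz_mod_dvd !modz_nat eqz_nat eq_sym.
- apply/allP => _ /mapP[z /sub/gY zY ->]; by move: zY; rewrite inE.
Qed.

(* Induction on k, with g a polynomial in the last variable of degree < n having
   a coefficient g_j != 0: either p^(B q) divides g_j at the first k coordinates,
   or the last coordinate lies in one of fewer than n classes modulo p^q. Both
   cases lose a factor p^q as soon as (B + n) q <= e. *)
Lemma card_mpoly_zeros k (g : mpoly k int) : g != 0 ->
  exists B C, (0 < B)%N /\ forall m e, (e <= m)%N ->
    (#|[set x : {ffun 'I_k -> 'I_(p ^ m)} |
         ((p ^ e)%:Z %| meval (fun i => (x i : nat)%:Z) g)%Z]| * p ^ (e %/ B)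
       <= C * p ^ (m * k))%N.
Proof.
elim: k g => [|k IHk] g g0.
  pose c := mcoeff mnm0 g.
  have gE : g = mpolyC 0 c by exact: nvar0_mpolyC.
  have c0 : c != 0 by apply: contraNneq g0 => c0; rewrite gE c0 mpolyC0.
  (* Without variables there is at most one zero, and if there is one then [p ^ e] divides [c], so
     it is at most the absolute value of [c]. *)
  exists 1%N, `|c|%N; split=> // m e em; rewrite muln0 expn0 muln1 divn1.
  have [pe|pe] := boolP ((p ^ e)%:Z %| c)%Z; last first.
    rewrite (_ : finset _ = finset.set0) ?cards0 //.
    by apply/setP => x; rewrite !inE gE mevalC (negbTE pe).
  have le1 : (#|[set x : {ffun 'I_0 -> 'I_(p ^ m)} |
      ((p ^ e)%:Z %| meval (fun i => (x i : nat)%:Z) g)%Z]| <= 1)%N.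
    by rewrite (leq_trans (max_card _)) // card_ffun !card_ord expn0.
  by rewrite -[leqRHS]mul1n leq_mul // dvdn_leq ?absz_gt0.
have [j hj0] := muni_neq0 g0.
have [B [C [B0 BC]]] := IHk _ hj0.
pose n := size (muni g).
exists (B + n)%N, (C + n)%N; split=> [|m e em]; first by rewrite addn_gt0 B0.
pose q := (e %/ (B + n))%N.
have qe : (B * q + q * n <= e)%N.
  by rewrite (mulnC q) -mulnDl mulnC leq_trunc_div.
have qm : (q <= m)%N.
  rewrite (leq_trans _ em) // (leq_trans _ qe) //.
  by rewrite (leq_trans _ (leq_addr _ _)) // leq_pmull.
pose h (x : {ffun 'I_k -> 'I_(p ^ m)}) :=
  map_poly (meval (fun i => (x i : nat)%:Z)) (muni g).
(* The exponent [B * q] makes the saving in the induction hypothesis exactly [p ^ q]. *)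
pose W := [set x : {ffun 'I_k -> 'I_(p ^ m)} | ((p ^ (B * q))%:Z %| (h x)`_j)%Z].
have WE : (#|W| * p ^ q <= C * p ^ (m * k))%N.
  have Bqm : (B * q <= m)%N.
    by rewrite (leq_trans _ em) // (leq_trans _ qe) // leq_addr.
  have := BC m _ Bqm; rewrite mulKn //; apply: leq_trans.
  rewrite leq_mul2r; apply/orP; right; apply/subset_leq_card/fintype.subsetP => x.
  by rewrite !inE coef_map.
set Z := [set x | _].
pose f (x : {ffun 'I_k.+1 -> 'I_(p ^ m)}) :=
  ([ffun i => x (widen_ord (leqnSn k) i)], x ord_max).
have f_inj : injective f.
  move=> x y [/ffunP xy xym]; apply/ffunP => i.
  have [->//|i0] := eqVneq i ord_max.
  have ik : (i < k)%N by rewrite ltn_neqAle -ltnS ltn_ord andbT -val_eqE in i0 *.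
  have := xy (Ordinal ik); rewrite !ffunE (_ : widen_ord _ _ = i) //.
  exact: val_inj.
pose V x := [set y : 'I_(p ^ m) |
  ((p ^ (B * q + q * n))%:Z %| (h x).[(y : nat)%:Z])%Z].
have ZE : (#|Z| <= \sum_x #|V x|)%N.
  rewrite -(card_imset _ f_inj).
  under eq_bigr do rewrite -sum1_card.
  rewrite pair_big_dep /= sum1_card; apply/subset_leq_card/fintype.subsetP
    => _ /imsetP[x xZ ->].
  move: xZ; rewrite inE meval_muni => gx.
  have hE : h [ffun i => x (widen_ord (leqnSn k) i)] =
      map_poly (meval (fun i => (x (widen_ord (leqnSn k) i) : nat)%:Z)) (muni g).
    by apply: eq_map_poly => c; apply: meval_eq => i; rewrite ffunE.
  suff : x ord_max \in V (f x).1 by [].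
  by rewrite inE hE; apply: dvdz_trans gx; exact: (dvdn_exp2l p qe).
apply: leq_trans (leq_mul ZE (leqnn _)) _; rewrite -/q.
(* Points over [W], where the last coordinate is left free, give the term with [C]; the other points
   give the term with [n]. *)
rewrite (bigID [in W]) /= !mulnDl leq_add //.
  have S1 : (\sum_(x in W) #|V x| <= #|W| * p ^ m)%N.
    rewrite -sum_nat_const leq_sum // => x _.
    by rewrite (leq_trans (max_card _)) // card_ord.
  apply: leq_trans (leq_mul S1 (leqnn _)) _.
  by rewrite mulnAC mulnS expnD [(p ^ m * _)%N]mulnC mulnA leq_mul.
have -> : (n * p ^ (m * k.+1) = (p ^ (m * k) * (n * p ^ (m - q))) * p ^ q)%N.
  by rewrite -!mulnA -expnD subnK // mulnCA -expnD mulnS addnC.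
rewrite leq_mul2r; apply/orP; right.
have -> : (p ^ (m * k) = #|{ffun 'I_k -> 'I_(p ^ m)}|)%N.
  by rewrite card_ffun !card_ord expnM.
rewrite -sum_nat_const [leqRHS](bigID [in W]) /= (leq_trans _ (leq_addl _ _)) //.
apply: leq_sum => x; rewrite inE => xW.
by apply: card_poly_zeros_mod xW => //; rewrite size_poly.
Qed.

End Counting.

(** * Reduction of polynomial values modulo powers of [p] *)

Lemma Zp_int_eq0 n (c : int) : (1 < n)%N -> (c%:~R == 0 :> 'Z_n) = (n%:Z %| c)%Z.
Proof.
move=> n1; have nat0 k : (k%:R == 0 :> 'Z_n) = (n %| k)%N.
  by rewrite -val_eqE /= val_Zp_nat.
case: c => c; first by rewrite -pmulrn nat0.
by rewrite NegzE mulrNz oppr_eq0 -pmulrn nat0.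
Qed.

Lemma res_mmap p k (x : 'I_k -> padic p) (g : mpoly k int) n :
  res (mmap intr x g) n = mmap intr (fun i => res (x i) n) g.
Proof.
have resX (y : padic p) m : res (y ^+ m) n = res y n ^+ m.
  by elim: m => [|m IHm] //; rewrite !exprS resM IHm.
have resZ c : res (c%:~R : padic p) n = c%:~R.
  case: c => c; first by rewrite -!pmulrn res_nat.
  by rewrite NegzE !mulrNz resN -!pmulrn res_nat.
rewrite /mmap res_sum; apply: eq_bigr => m _; rewrite resM resZ; congr (_ * _).
rewrite /mmap1 (big_morph (fun y : padic p => res y n)
  (fun x y => resM x y n) (res1 p n)).
by apply: eq_bigr => i _.
Qed.

Lemma mmap_intr_nat k (R : comNzRingType) (z : 'I_k -> nat) (g : mpoly k int) :
  mmap intr (fun i => (z i)%:R : R) g = (meval (fun i => (z i)%:Z) g)%:~R.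
Proof.
rewrite mevalE /mmap rmorph_sum; apply: eq_bigr => m _.
rewrite rmorphM /=; congr (_ * _).
rewrite /mmap1 rmorph_prod; apply: eq_bigr => i _.
by rewrite rmorphXn /= -pmulrn.
Qed.

(** * Digit blocks of the partial sums of [xi] *)

Section Digits.
Variable p : nat.
Hypothesis pr_p : prime p.

(** When each [u n] is below [p ^ (2 ^ n.+1 - 2 ^ n)], it fills the base-[p] places from [2 ^ n - 1]
    to [2 ^ n.+1 - 2], so the blocks are adjacent and do not overlap. *)
Definition digit_sum (u : nat -> nat) N :=
  (\sum_(0 <= n < N) p ^ (2 ^ n - 1) * u n)%N.

Lemma digit_sum_lt u N : (forall n, (n < N)%N -> (u n < p ^ (2 ^ n.+1 - 2 ^ n))%N) ->
  (digit_sum u N < p ^ (2 ^ N - 1))%N.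
Proof.
rewrite /digit_sum; elim: N => [|N IHN] hu; first by rewrite big_geq.
rewrite big_nat_recr //=; set e := (2 ^ N - 1)%N.
have -> : (2 ^ N.+1 - 1 = e + (2 ^ N.+1 - 2 ^ N))%N.
  by rewrite /e expnS; have := expn_gt0 2 N; lia.
have {}IHN := IHN (fun n nN => hu n (ltnW nN)).
apply: leq_trans (_ : p ^ e * (u N).+1 <= _)%N; first by rewrite mulnS ltn_add2r.
by rewrite expnD leq_mul2l hu ?orbT.
Qed.

(** The quotient removes the blocks below level [n], the remainder those above it. *)
Lemma digit_sumK u N n : (forall n, (n < N)%N -> (u n < p ^ (2 ^ n.+1 - 2 ^ n))%N) ->
  (n < N)%N ->
  ((digit_sum u N %/ p ^ (2 ^ n - 1)) %% p ^ (2 ^ n.+1 - 2 ^ n) = u n)%N.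
Proof.
have pe e : (0 < p ^ e)%N by rewrite expn_gt0 prime_gt0.
elim: N => [//|N IHN] hu; rewrite ltnS leq_eqVlt => /orP[/eqP ->|nN].
  rewrite /digit_sum big_nat_recr //= addnC mulnC divnMDl //.
  rewrite divn_small ?addn0 ?modn_small ?hu //.
  exact: (digit_sum_lt (fun n nN => hu n (ltnW nN))).
rewrite /digit_sum big_nat_recr //= -/(digit_sum u N) addnC.
have -> : (2 ^ N - 1 = (2 ^ n - 1) + ((2 ^ n.+1 - 2 ^ n) + (2 ^ N - 2 ^ n.+1)))%N.
  have : (2 ^ n.+1 <= 2 ^ N)%N by rewrite leq_exp2l.
  by rewrite expnS; have := expn_gt0 2 n; lia.
rewrite expnD -mulnA mulnC divnMDl // expnD -mulnA mulnC modnMDl.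
by rewrite IHN // => m mN; apply/hu/ltnW.
Qed.

(** The terms from level [N] on are divisible by [p ^ (2 ^ N - 1)], hence by the modulus
    [p ^ k.+1]. *)
Lemma res_xi (a : seq bool -> nat) (f : nat -> bool) N k : (k.+1 < 2 ^ N)%N ->
  res (xi p a f) k = (digit_sum (fun n => a (mkseq f n)) N)%:R.
Proof.
move=> kN; have /padic_cvgP/(_ k)[K _] := @xi_cvg p a f pr_p.
move=> /(_ (maxn K N) (leq_maxl _ _))/= <-.
rewrite (big_cat_nat (n := N)) ?leq_maxr // resD [X in _ + X]res_sum.
rewrite [X in _ + X]big_nat [X in _ + X]big1 ?addr0 => [|n /andP[Nn _]].
  rewrite -[RHS]res_nat; apply: (congr1 (fun x : padic p => res x k)).
  rewrite natr_sum; apply: eq_bigr => n _.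
  by rewrite natrM natrX.
rewrite -natrX -natrM res_nat; apply/eqP; rewrite pmulrn Zp_int_eq0.
  apply: dvdn_mulr; apply: dvdn_exp2l.
  have : (2 ^ N <= 2 ^ n)%N by rewrite leq_exp2l.
  by lia.
by rewrite -{1}(expn0 p) ltn_exp2l ?prime_gt1.
Qed.

Lemma meval_digit_sum_dvd (a : seq bool -> nat) k (g : mpoly k int)
    (f : 'I_k -> nat -> bool) N :
  (0 < N)%N -> mmap intr (xi p a \o f) g = 0 ->
  ((p ^ (2 ^ N - 1))%:Z %|
     meval (fun i => (digit_sum (fun n => a (mkseq (f i) n)) N)%:Z) g)%Z.
Proof.
(* The component of index [n] lives modulo [p ^ n.+1], hence the index [2 ^ N - 2]. *)
move=> N0 /(congr1 (fun x => res x (2 ^ N - 2)))/eqP.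
have N2 : (2 <= 2 ^ N)%N by rewrite -{1}(expn1 2) leq_exp2l.
have NE : ((2 ^ N - 2).+1 = 2 ^ N - 1)%N by lia.
rewrite res_mmap.
have -> : (fun i => res ((xi p a \o f) i) (2 ^ N - 2)) =
  fun i => (digit_sum (fun n => a (mkseq (f i) n)) N)%:R.
  by apply/funext => i; apply: res_xi; lia.
rewrite mmap_intr_nat res0 Zp_int_eq0 ?NE //.
by rewrite -{1}(expn0 p) ltn_exp2l ?prime_gt1 //; lia.
Qed.

End Digits.

Local Open Scope classical_set_scope.

(** * Choice of the levels [N] and [M] *)

Lemma linear_lt_expn2 a b M : exists2 N, (M < N)%N & (N * a + b < 2 ^ N)%N.
Proof.
pose j := (2 * a + b + M)%N.
have Hj : (j < 2 ^ j)%N by rewrite ltn_expl.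
(* Here [2 ^ N] is at least [2 * (j + 1) ^ 2], while [N * a + b] is at most [j ^ 2 + j]. *)
exists (2 * j).+1; first by rewrite /j; lia.
rewrite expnS mul2n -addnn expnD.
have : (j.+1 * j.+1 <= 2 ^ j * 2 ^ j)%N by rewrite leq_mul.
rewrite /j; nia.
Qed.

(** Bounding [K] by [2 ^ K] leaves an exponent linear in [N] on the left. *)
Lemma expn_dominated B k K M : (0 < B)%N ->
  exists2 N, (M < N)%N & (2 ^ (N * k) * K <= 2 ^ ((2 ^ N - 1) %/ B))%N.
Proof.
move=> B0; have [N MN NB] := linear_lt_expn2 (k * B) (K * B) M.
exists N => //; apply: leq_trans (_ : 2 ^ (N * k + K) <= _)%N.
  by rewrite expnD leq_mul2l ltnW ?orbT // ltn_expl.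
by rewrite leq_exp2l // leq_divRL // mulnDl -mulnA; lia.
Qed.

(** Each of the finitely many pairs is told apart at some position; [M] exceeds all of these. *)
Lemma mkseq_separate k (f : 'I_k -> nat -> bool) : injective f ->
  exists M, injective (fun i => mkseq (f i) M).
Proof.
move=> f_inj.
have /choice[n nP] (ij : 'I_k * 'I_k) :
    exists n, ij.1 != ij.2 -> f ij.1 n != f ij.2 n.
  case: ij => i j /=; have [_|ij] := eqVneq i j; first by exists 0%N.
  apply: contrapT => /forallNP H; case/eqP: ij; apply: f_inj.
  apply/funext => n; apply/eqP/negP => fn; apply: (H n) => _; exact/negP.
exists (\max_ij n ij).+1 => i j /= fij; apply/eqP/negPn/negP => ij.
have /negP := nP (i, j) ij; apply; apply/eqP => /=.
have nM : (n (i, j) < (\max_ij n ij).+1)%N by rewrite ltnS leq_bigmax.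
by rewrite -(nth_mkseq false (f i) nM) fij nth_mkseq.
Qed.

(** * Null sets, union bounds and cylinder events *)

Section Measure.
Context d (T : measurableType d) (R : realType) (P : probability T R).

Lemma negligible_bigcup_countable (I : countType) (F : I -> set T) :
  (forall i, P.-negligible (F i)) -> P.-negligible (\bigcup_i F i).
Proof.
move=> F0; pose G n := if choice.unpickle n is Some i then F i else set0.
apply: (@negligibleS _ _ _ _ (\bigcup_n G n)).
  by move=> x [i _ Fix]; exists (choice.pickle i) => //; rewrite /G choice.pickleK.
apply: negligible_bigcup => n; rewrite /G; case: (choice.unpickle n) => [i|].
  exact: F0.
exact: negligible_set0.
Qed.

(** The intersection of the covers is a measurable null set. [A] need not be measurable, which
    matters for events quantifying over uncountably many sequences. *)
Lemma negligible_small (A : set T) :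
  (forall L, exists E, [/\ measurable E, A `<=` E & (P E <= (L.+1%:R^-1)%:E)%E]) ->
  P.-negligible A.
Proof.
move=> /choice[E EP].
have mE : measurable (\bigcap_L E L).
  by apply: bigcap_measurable => // L _; case: (EP L).
exists (\bigcap_L E L); split=> //; last first.
  by move=> x Ax L _; case: (EP L) => _ /(_ x Ax).
apply/eqP; rewrite -measure_le0; apply/lee_addgt0Pr => e e0; rewrite add0e.
have [L Le] : exists L, (L.+1%:R^-1 <= e)%R.
  exists (Num.truncn e^-1); rewrite invf_ple ?posrE //.
  exact/ltW/truncnS_gt.
apply: (@le_trans _ _ (P (E L))); last first.
  by case: (EP L) => _ _ /le_trans -> //; rewrite lee_fin.
by apply: le_measure; rewrite ?inE //; [case: (EP L)|exact: bigcap_inf].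
Qed.

Lemma measure_bigsetU_le (I : finType) (D : {pred I}) (F : I -> set T) (c : R) :
  (forall i, i \in D -> measurable (F i)) ->
  (forall i, i \in D -> P (F i) <= c%:E)%E ->
  measurable (\big[setU/set0]_(i in D) F i) /\
  (P (\big[setU/set0]_(i in D) F i) <= (#|D|%:R * c)%:E)%E.
Proof.
move=> mF Fc; split; first exact: bigsetU_measurable.
rewrite mulr_natl -sumr_const -sumEFin.
(* Measurability is carried along the induction because subadditivity asks for it. *)
suff [] : measurable (\big[setU/set0]_(i in D) F i) /\
   (P (\big[setU/set0]_(i in D) F i) <= \sum_(i in D) c%:E)%E by [].
elim/big_rec2 : _ => [|i x A iD [mA Ax]]; first by rewrite measure0.
split; first by apply: measurableU => //; exact: mF.
apply: le_trans (measureU2 _ _ _) _ => //; first exact: mF.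
by apply: leeD => //; exact: Fc.
Qed.

Lemma uniform_below_negligible N (X : {RV P >-> nat}) : (0 < N)%N ->
  uniform_below N X -> P.-negligible [set w | (N <= X w)%N].
Proof.
move=> N0 unifX.
have mX B : measurable (X @^-1` B).
  by rewrite -[_ @^-1` _]setTI; exact: measurable_funPT.
have -> : [set w | (N <= X w)%N] =
    ~` (\big[setU/set0]_(i < N) (X @^-1` [set (i : nat)])).
  apply/seteqP; split => w /=; rewrite -(bigcup_mkord N (fun i => X @^-1` [set i])).
    by move=> NX [i /= iN]; rewrite /= => XE; move: NX; rewrite XE leqNgt iN.
  move=> H; rewrite leqNgt; apply/negP => XN; apply: H; by exists (X w).
apply/negligibleP; first by apply: measurableC; apply: bigsetU_measurable.
apply: etrans (probability_setC P _) _; first exact: bigsetU_measurable.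
rewrite (@measure_bigsetU _ _ _ P (fun i => X @^-1` [set i])) //; last first.
  by move=> i j _ _ [w [/= <- <-]].
rewrite (eq_bigr (fun=> (N%:R^-1)%:E)) => [|i _]; last exact: unifX.
rewrite sumEFin sumr_const card_ord -[_ *+ N]mulr_natl mulfV ?subee // pnatr_eq0.
by rewrite -lt0n.
Qed.

Lemma indep_cylinder (J : finType) (a : seq bool -> {RV P >-> nat})
    (N : seq bool -> nat) (s : J -> seq bool) (v : J -> nat) :
  mutually_independent a -> (forall s, uniform_below (N s) (a s)) ->
  injective s -> (forall j, v j < N (s j))%N ->
  P (\bigcap_j (a (s j) @^-1` [set v j])) = (\prod_j ((N (s j))%:R^-1))%:E.
Proof.
move=> indep unif s_inj vN.
pose F := seq_fset tt [seq s j | j <- enum J].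
(* The prescribed values, reindexed by nodes; 0 is a default off the image of [s]. *)
pose u r := odflt 0%N (omap v [pick j | s j == r]).
have uE j : u (s j) = v j.
  rewrite /u; case: pickP => [j' /eqP/s_inj -> //|/(_ j)]; by rewrite eqxx.
have FE r : (r \in F) = (r \in [seq s j | j <- enum J]) by rewrite seq_fsetE.
have := indep F (fun r => [set u r]) (fun _ _ => I).
have -> : \bigcap_(i in [set` F]) (a i @^-1` [set u i]) =
    \bigcap_j (a (s j) @^-1` [set v j]).
  apply/seteqP; split => w /= H.
    by move=> j _; rewrite /= -uE; apply: H; rewrite /= FE map_f ?mem_enum.
  by move=> r /=; rewrite FE => /mapP[j _ ->]; rewrite uE; exact: H.
move=> ->.
have -> : (\prod_(r <- F) P (a r @^-1` [set u r]) =
   \prod_(r <- [seq s j | j <- enum J]) P (a r @^-1` [set u r]))%E.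
  apply: perm_big; apply: uniq_perm => //.
  by rewrite map_inj_uniq // enum_uniq.
rewrite big_map big_enum -prodEFin; apply: eq_bigr => j _.
by rewrite uE unif.
Qed.

End Measure.

(** * Probability of the exceptional events *)

Lemma sum_digit_lengths M N : (M <= N)%N ->
  (\sum_(j < N - M) (2 ^ (j + M).+1 - 2 ^ (j + M)) = 2 ^ N - 2 ^ M)%N.
Proof.
move=> MN; rewrite -(@telescope_sumn_in M N (fun n => 2 ^ n)%N) //.
  by rewrite -[in RHS](add0n M) big_addn big_mkord.
by move=> *; rewrite leq_exp2l.
Qed.

Section Main.
Context (p : nat) (pr_p : prime p) d (T : measurableType d) (R : realType)
  (P : probability T R) (a : seq bool -> {RV P >-> nat}).
Hypothesis a_unif : forall s : seq bool,
  uniform_below (p ^ (2 ^ (size s).+1 - 2 ^ size s)) (a s).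
Hypothesis a_indep : mutually_independent a.

(** Uniformity bounds the digits only almost surely, while decoding the blocks needs the bound at
    the given [w]. *)
Definition in_range : set T :=
  [set w | forall s, (a s w < p ^ (2 ^ (size s).+1 - 2 ^ size s))%N].

Lemma in_rangeC_negligible : P.-negligible (~` in_range).
Proof.
apply: (@negligibleS _ _ _ _
  (\bigcup_s [set w | (p ^ (2 ^ (size s).+1 - 2 ^ size s) <= a s w)%N])).
  by move=> w /existsNP[s /negP]; rewrite -leqNgt => ?; exists s.
apply: negligible_bigcup_countable => s; apply: uniform_below_negligible => //.
by rewrite expn_gt0 prime_gt0.
Qed.

(** The level [M] is fixed in the event so that nodes of different sequences are distinct from level
    [M] on. *)
Definition exceptional k (g : mpoly k int) M : set T :=
  [set w | in_range w /\ exists f : 'I_k -> nat -> bool,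
     injective (fun i => mkseq (f i) M) /\
     mmap intr (xi p (fun s => a s w) \o f) g = 0].

Definition digit n x := ((x %/ p ^ (2 ^ n - 1)) %% p ^ (2 ^ n.+1 - 2 ^ n))%N.

(* Digits below level M may be shared by several sequences, so only the
   levels M .. N - 1 are used. *)
Definition node k N M (t : {ffun 'I_k -> N.-tuple bool}) (ij : 'I_k * 'I_(N - M)) :=
  take (ij.2 + M) (t ij.1).

Lemma size_node k N M (t : {ffun 'I_k -> N.-tuple bool}) (ij : 'I_k * 'I_(N - M)) :
  size (node t ij) = (ij.2 + M)%N.
Proof. by rewrite size_takel // size_tuple; have := ltn_ord ij.2; lia. Qed.

(** [t] prescribes the prefixes of length [N], [z] the residues modulo [p ^ (2 ^ N - 1)]. *)
Definition digit_event k N M (t : {ffun 'I_k -> N.-tuple bool})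
    (z : {ffun 'I_k -> 'I_(p ^ (2 ^ N - 1))}) : set T :=
  \bigcap_(ij : 'I_k * 'I_(N - M))
    (a (node t ij) @^-1` [set digit (ij.2 + M) (z ij.1)]).

Lemma measurable_digit_event k N M t z : measurable (@digit_event k N M t z).
Proof.
apply: fin_bigcap_measurable => [|ij _]; first exact: finite_finset.
by rewrite -[_ @^-1` _]setTI; exact: measurable_funPT.
Qed.

(** The length of a node determines its level and its first [M] entries determine the sequence, so
    the nodes are distinct and independence applies. For each sequence the block lengths
    telescope. *)
Lemma prob_digit_event k N M (t : {ffun 'I_k -> N.-tuple bool}) z : (M <= N)%N ->
  injective (fun i => take M (t i)) ->
  P (digit_event M t z) = ((p ^ (k * (2 ^ N - 2 ^ M)))%:R^-1)%:E.
Proof.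
move=> MN t_inj; have pe e : (0 < p ^ e)%N by rewrite expn_gt0 prime_gt0.
have node_inj : injective (@node k N M t).
  move=> [i j] [i' j'] E.
  have /addIn/val_inj jj' : (j + M = j' + M)%N.
    by have := congr1 size E; rewrite !size_node.
  congr (_, _) => //; apply: t_inj; rewrite /= /node /= -jj' in E *.
  by have := congr1 (take M) E; rewrite !take_takel // leq_addl.
rewrite (indep_cylinder (J := ('I_k * 'I_(N - M))%type)
  (v := fun ij => digit (ij.2 + M) (z ij.1)) a_indep a_unif node_inj); last first.
  by move=> ij; rewrite size_node ltn_mod.
congr (_%:E).
under eq_bigr do rewrite size_node.
rewrite -(pair_big xpredT xpredT
  (fun (_ : 'I_k) (j : 'I_(N - M)) =>
     (p ^ (2 ^ (j + M).+1 - 2 ^ (j + M)))%:R^-1 : R)) /=.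
rewrite prodr_const card_ord prodfV -natr_prod -expn_sum sum_digit_lengths //.
by rewrite exprVn -natrX -expnM mulnC.
Qed.

(** The uncountable choice of [f] is replaced by the finite choice of prefixes and residues, here
    those read off at [w]. *)
Lemma exceptional_sub k (g : mpoly k int) N M : (M <= N)%N -> (0 < N)%N ->
  exceptional g M `<=` \big[setU/set0]_(tz in finset.setX
     [set t : {ffun 'I_k -> N.-tuple bool} | injectiveb (fun i => take M (t i))]%SET
     [set z : {ffun 'I_k -> 'I_(p ^ (2 ^ N - 1))} |
        ((p ^ (2 ^ N - 1))%:Z %| meval (fun i => (z i : nat)%:Z) g)%Z]%SET)
   digit_event M tz.1 tz.2.
Proof.
move=> MN N0 w [w_range [f [f_inj gf]]].
have range i n : (n < N)%N ->
    (a (mkseq (f i) n) w < p ^ (2 ^ n.+1 - 2 ^ n))%N.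
  by move=> _; have := w_range (mkseq (f i) n); rewrite size_mkseq.
pose t := [ffun i => [tuple of mkseq (f i) N]] : {ffun 'I_k -> N.-tuple bool}.
pose z := [ffun i =>
  Ordinal (digit_sum_lt (u := fun n => a (mkseq (f i) n) w) pr_p (range i))].
have tE i n : (n <= N)%N -> take n (t i) = mkseq (f i) n.
  by move=> nN; rewrite ffunE /= /mkseq -map_take take_iota (minn_idPl nN).
rewrite -bigcup_seq_cond; exists (t, z) => /=.
  rewrite mem_index_enum !inE /=; apply/andP; split.
    by apply/injectiveP => i j /=; rewrite !tE // => /f_inj.
  have := meval_digit_sum_dvd pr_p N0 gf; congr (_ %| _)%Z.
  by apply: meval_eq => i; rewrite ffunE.
move=> [i j] _ /=; have jN : (j + M < N)%N by have := ltn_ord j; lia.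
rewrite /node /= tE ?(ltnW jN) // ffunE /digit /=.
by rewrite (digit_sumK pr_p (range i)).
Qed.

Lemma exceptional_negligible k (g : mpoly k int) M : g != 0 ->
  P.-negligible (exceptional g M).
Proof.
move=> g0; have [B [C [B0 BC]]] := card_mpoly_zeros pr_p g0.
apply: negligible_small => L.
(* The constant gathers the counting factor [C], the loss from the ignored levels below [M], and the
   target [L.+1]. *)
have [N MN NL] := expn_dominated k (C * p ^ (k * 2 ^ M) * L.+1)%N M B0.
have := @exceptional_sub k g N M (ltnW MN) (leq_ltn_trans (leq0n _) MN).
set D := finset.setX _ _; set E := \big[setU/set0]_(tz in D) _ => excE.
have [] := @measure_bigsetU_le _ _ _ P _ [in D] (fun tz => digit_event M tz.1 tz.2)
  ((p ^ (k * (2 ^ N - 2 ^ M)))%:R^-1) (fun tz _ => measurable_digit_event _ _ _).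
  move=> [t z]; rewrite inE => /andP[]; rewrite inE => /injectiveP t_inj _.
  by rewrite (prob_digit_event _ (ltnW MN)).
rewrite -/E => mE PE; exists E; split=> //; apply: le_trans PE _.
have pe e : (0 < p ^ e)%N by rewrite expn_gt0 prime_gt0.
rewrite lee_fin ler_pdivrMr ?ltr0n // ler_pdivlMl ?ltr0n // -natrM ler_nat.
set m := (2 ^ N - 1)%N in D E excE mE *.
have DE : (#|D| * p ^ (m %/ B) <= 2 ^ (N * k) * (C * p ^ (m * k)))%N.
  rewrite cardsX -mulnA leq_mul ?BC //.
  by rewrite (leq_trans (max_card _)) // card_ffun card_tuple
    card_bool card_ord expnM.
(* Multiplying both sides by [p ^ (m %/ B)] allows [DE] to be used without division. *)
rewrite -(leq_pmul2r (pe (m %/ B)%N)) -mulnA.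
apply: leq_trans (leq_mul (leqnn _) DE) _.
have mk : (m * k <= k * (2 ^ N - 2 ^ M) + k * 2 ^ M)%N.
  rewrite -mulnDr subnK ?leq_exp2l ?(ltnW MN) // mulnC leq_mul2l /m.
  by rewrite leq_subr orbT.
have {}mk : (p ^ (m * k) <= p ^ (k * (2 ^ N - 2 ^ M)) * p ^ (k * 2 ^ M))%N.
  by rewrite -expnD leq_pexp2l ?prime_gt0.
have {}NL : (2 ^ (N * k) * (C * p ^ (k * 2 ^ M) * L.+1) <= p ^ (m %/ B))%N.
  (* Base 2 is replaced by base [p]; exponent 0 is split off because [leq_exp2r] needs a positive
     exponent. *)
  apply: leq_trans NL _; case: (m %/ B)%N => // e.
  by rewrite leq_exp2r // prime_gt1.
apply: leq_trans (_ : p ^ (k * (2 ^ N - 2 ^ M)) *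
   (2 ^ (N * k) * (C * p ^ (k * 2 ^ M) * L.+1)) <= _)%N;
  last by rewrite leq_mul2l NL orbT.
apply: leq_trans (_ : L.+1 * (2 ^ (N * k) *
   (C * (p ^ (k * (2 ^ N - 2 ^ M)) * p ^ (k * 2 ^ M)))) <= _)%N.
  by rewrite !leq_mul.
by apply/eq_leq; ring.
Qed.

End Main.

(** * Countable union over polynomials and levels *)

Lemma mpoly_of_terms k (g : mpoly k int) :
  exists c : seq (multinom k * int), \sum_(mx <- c) mx.2 *: mpolyX int mx.1 = g.
Proof.
exists [seq (m, mcoeff m g) | m <- msupp g]; rewrite big_map; exact/esym/mpolyE.
Qed.

Theorem lemma3p3 (p : nat) (pr_p : prime p)
    (d : measure_display) (T : measurableType d) (R : realType)
    (P : probability T R) (a : seq bool -> {RV P >-> nat})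
    (a_unif : forall s : seq bool,
       uniform_below (p ^ (2 ^ (size s).+1 - 2 ^ size s)) (a s))
    (a_indep : mutually_independent a) :
  {ae P, forall w : T,
     algebraically_independent (xi p (fun s => a s w))}.
Proof.
(* Polynomials are indexed by lists of terms, which form a countable type. *)
pose poly_of k (c : seq (multinom k * int)) :=
  \sum_(mx <- c) mx.2 *: mpolyX int mx.1.
(* A list may represent the zero polynomial, to which the zero count does not apply. *)
pose F k c M := if poly_of k c == 0 then set0 else exceptional p a (poly_of k c) M.
apply: (@negligibleS _ _ _ _ (~` in_range p a `|`
    \bigcup_k \bigcup_c \bigcup_M F k c M)).
  move=> w /= w_dep; have [w_range|?] := pselect (in_range p a w); last by left.
  right; apply: contrapT => H; apply: w_dep => k f _ f_inj g g0.
  apply/eqP => gf; apply: H.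
  have [M fM] := mkseq_separate f_inj; have [c cE] := mpoly_of_terms g.
  exists k => //; exists c => //; exists M => //.
  by rewrite /F /poly_of cE (negbTE g0); split => //; exists f.
apply: negligibleU; first exact: in_rangeC_negligible.
apply: negligible_bigcup_countable => k.
apply: negligible_bigcup_countable => c.
apply: negligible_bigcup_countable => M.
rewrite /F; case: eqVneq => [_|g0]; first exact: negligible_set0.
exact: exceptional_negligible.
Qed.
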